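(* Let $\mathbb{K}$ be a field, $E$ a finite set and $W\subseteq\mathbb{K}^E$ a configuration. Then there is a subset $F\subseteq E$ of size $|F|=r_{W_F}^2\le r_W^2$ such that $\psi_W\simeq\psi_{W_F}$ and such that, if $\operatorname{ch}\mathbb{K}=0$ or $\operatorname{ch}\mathbb{K}>r_W$, any polynomial $\phi\simeq\psi_{W_F}$ depends on at least $|F|$ variables. In other words, in the latter case, among the polynomials equivalent to $\psi_W$ with minimal number of variables is the configuration polynomial $\psi_{W_F}$.
   Context: For a finite set $E$, $\mathbb{K}^E$ is the $\mathbb{K}$-vector space with canonical basis $E$; for $w\in\mathbb{K}^E$, $w_e$ denotes its $e$-component. A configuration is a $\mathbb{K}$-linear subspace $W\subseteq\mathbb{K}^E$, of rank $r_W:=\dim_{\mathbb{K}}W$. For $F\subseteq E$, $\pi_F\colon\mathbb{K}^E\to\mathbb{K}^F$ is the coordinate projection and $W_F:=\pi_F(W)\subseteq\mathbb{K}^F$, again a configuration. The Hadamard product of $u,v\in\mathbb{K}^E$ is the componentwise product $u\star v=\sum_{e}u_ev_e\,e$; $W^{\star 2}$ is the linear span of all $u\star v$ with $u,v\in W$, and $r_W^2:=\dim_{\mathbb{K}}W^{\star2}$ (the superscript $2$ is an index, not a square). Configuration polynomial: for a basis $w^1,\dots,w^r$ of $W$ and variables $x=(x_e)_{e\in E}$, $\psi_W:=\det\left(\sum_{e\in E}x_e w^i_e w^j_e\right)_{1\le i,j\le r}\in\mathbb{K}[x]$; it is determined by $W$ up to a square factor in $\mathbb{K}^*$. (Linear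 contact) equivalence: for polynomials $\phi\in\mathbb{K}[x_1,\dots,x_m]$ and $\psi\in\mathbb{K}[x_1,\dots,x_n]$, $\phi\simeq\psi$ means that for some $p\ge m,n$ there are $\ell\in\operatorname{GL}_p(\mathbb{K})$ and $\lambda\in\mathbb{K}^*$ with $\phi=\lambda\cdot\psi\circ\ell$ in $\mathbb{K}[x_1,\dots,x_p]$. Configuration polynomials are compared by enumerating $E$ (the enumeration does not affect the equivalence class). *)

(* Defs.v *)
From HB Require Import structures.
From mathcomp Require Import all_boot all_order all_algebra.
From mathcomp Require Import mpoly.

Set Implicit Arguments.
Unset Strict Implicit.
Unset Printing Implicit Defensive.

Import GRing.Theory.
Local Open Scope ring_scope.

(* K^E; a configuration is an element of {vspace coordspace K E}. *)
Notation coordspace K E := {ffun E -> K^o}.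

Section Configuration.
Variables (K : fieldType) (E : finType).
Implicit Types (W U : {vspace coordspace K E}) (u v : coordspace K E).

Definition restrict (F : {set E}) (w : coordspace K E) :
    coordspace K {e : E | e \in F} :=
  [ffun f => w (val f)].

Fact restrict_is_linear (F : {set E}) : linear (restrict F).
Proof. by move=> a u v; apply/ffunP=> f; rewrite !ffunE. Qed.

HB.instance Definition _ (F : {set E}) :=
  GRing.isLinear.Build K (coordspace K E) (coordspace K {e : E | e \in F}) _
    (restrict F) (restrict_is_linear F).

(* W_F *)
Definition conf_restrict (F : {set E}) W :
    {vspace coordspace K {e : E | e \in F}} :=
  (linfun (restrict F) @: W)%VS.

Definition hadamard u v : coordspace K E := [ffun e => u e * v e].

(* The span of all u * v with u, v in W, generated by the products of the
   vectors of a basis (as prodv does in falgebra); hadamard_sqP shows that it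
   is the smallest subspace containing all these products. *)
Definition hadamard_sq W : {vspace coordspace K E} :=
  <<[seq hadamard u v | u <- vbasis W, v <- vbasis W]>>%VS.

Lemma hadamard_sqP W U :
  reflect (forall u v, u \in W -> v \in W -> hadamard u v \in U)
          (hadamard_sq W <= U)%VS.
Proof.
apply: (iffP idP) => [sWU u v Wu Wv | WWU].
  have -> : hadamard u v = \sum_i \sum_j
      coord (vbasis W) i u *: (coord (vbasis W) j v *:
        hadamard (vbasis W)`_i (vbasis W)`_j).
    rewrite {1}(coord_vbasis Wu) {1}(coord_vbasis Wv).
    apply/ffunP=> e; rewrite !ffunE !sum_ffunE mulr_suml.
    apply: eq_bigr => i _; rewrite !sum_ffunE mulr_sumr.
    apply: eq_bigr => j _; rewrite !ffunE /=.
    by rewrite /GRing.scale /= -!mulrA; congr (_ * _); rewrite mulrCA.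
  apply: memv_suml => i _; apply: memv_suml => j _.
  apply/memvZ/memvZ/(subvP sWU)/memv_span.
  by apply: allpairs_f; apply: mem_nth; rewrite size_tuple.
apply/span_subvP=> _ /allpairsP[[u v] /= [Wu Wv ->]].
by apply: WWU; apply: vbasis_mem.
Qed.

(* r_W^2, where the superscript is an index. *)
Definition rank2 W : nat := \dim (hadamard_sq W).

(* The configuration polynomial for the vectors w; the variable x_e is
   'X_(enum_rank e). *)
Definition conf_poly (r : nat) (w : r.-tuple (coordspace K E)) :
    {mpoly K[#|E|]} :=
  \det (\matrix_(i < r, j < r)
    \sum_(e : E) ((tnth w i e * tnth w j e : K) *: 'X_(enum_rank e))).

End Configuration.

Section Equivalence.
Variable K : fieldType.

(* The inclusion of K[x_1, .., x_m] into K[x_1, .., x_p]. *)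
Definition widen_mpoly (m p : nat) (le_mp : (m <= p)%N) (f : {mpoly K[m]}) :
    {mpoly K[p]} :=
  f \mPo [tuple 'X_(widen_ord le_mp i) | i < m].

(* f \o l for the linear map x |-> l x on column vectors. *)
Definition lin_subst (p : nat) (l : 'M[K]_p) (f : {mpoly K[p]}) :
    {mpoly K[p]} :=
  f \mPo [tuple \sum_(j < p) l i j *: 'X_j | i < p].

Definition lin_equiv (m n : nat) (phi : {mpoly K[m]}) (psi : {mpoly K[n]}) :
    Prop :=
  exists (p : nat) (le_mp : (m <= p)%N) (le_np : (n <= p)%N)
         (l : 'M[K]_p) (lambda : K),
    [/\ l \in unitmx, lambda != 0 &
        widen_mpoly le_mp phi = lambda *: lin_subst l (widen_mpoly le_np psi)].

(* The number of variables on which phi depends, i.e. that occur in phi. *)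
Definition num_vars (m : nat) (phi : {mpoly K[m]}) : nat :=
  #|[set i : 'I_m | has (fun mon : 'X_{1..m} => mon i != 0%N) (msupp phi)]|.

End Equivalence.

(* Main.v *)
From HB Require Import structures.
Require Import Defs.
From mathcomp Require Import all_boot all_order all_algebra.
From mathcomp Require Import mpoly.

Set Implicit Arguments.
Unset Strict Implicit.
Unset Printing Implicit Defensive.

Import GRing.Theory.
Local Open Scope ring_scope.

(** Let [F] index a coordinate basis of [W^{*2}], so that every [e]-th
    coordinate function is, on [W^{*2}], a combination of those in [F]:
    [u_e = \sum_(f in F) c_ef u_f].  Applied to products of vectors of [W],
    this rewrites [\sum_e x_e w_e w_e^T] as [\sum_(f in F) y_f w_f w_f^T] with
    [y_f = \sum_e c_ef x_e], which gives the equivalence.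

    For the lower bound, if [phi] is equivalent to [psi_W] and depends on [k]
    variables, then [psi_W (x + t v) = psi_W x] for all [v] in a space of
    codimension at most [k].  Restricting [x] to the coordinates of a basis of
    columns of the matrix of [W] reduces this to [\det (D + t A) = \det D] for
    all diagonal [D], where [A] is congruent to [\sum_e v_e w_e w_e^T].  The
    principal minors of the symmetric matrix [A] then vanish; those of size 1
    and 2 give [A = 0], i.e. [v] is orthogonal to [W^{*2}], so the codimension
    of the space of such [v] is at least [r_W^2]. *)

(** * Linear algebra: matrices of full row rank and symmetric pencils *)

Section Matrices.
Variable K : fieldType.

Lemma row_free_colsub m n (A : 'M[K]_(m, n)) :
  row_free A -> exists2 f : 'I_m -> 'I_n, injective f & colsub f A \in unitmx.
Proof.
move=> freeA; have fullAt : row_full A^T by rewrite /row_full mxrank_tr.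
exists (fullrankfun fullAt); first exact: fullrankfun_inj.
have /row_fullP[B BA] := fullrowsub_full fullAt.
by rewrite -unitmx_tr; case/mulmx1_unit: BA => _; rewrite trmx_mxsub.
Qed.

(** As [A] has rank [n], it equals [row_mx (col_ebase A) 0 *m row_ebase A]; an identity block below
    the left factor supplies the missing rows. *)
Lemma row_free_complete n p (le_np : (n <= p)%N) (A : 'M[K]_(n, p)) :
  row_free A ->
  exists2 l : 'M[K]_p, l \in unitmx & forall i, row (widen_ord le_np i) l = row i A.
Proof.
move: (le_np) A; rewrite -(subnKC le_np); move: (p - n)%N => q le_nq A freeA.
exists (block_mx (col_ebase A) 0 0 1%:M *m row_ebase A).
  rewrite unitmx_mul row_ebase_unit andbT unitmxE det_ublock det1 mulr1.
  by rewrite -unitmxE col_ebase_unit.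
move=> i; have -> : widen_ord le_nq i = lshift q i by exact: val_inj.
rewrite -[block_mx _ _ _ _]/(col_mx _ _) mul_col_mx rowKu; congr row.
rewrite -[RHS]mulmx_ebase (eqP freeA) pid_mx_row; congr (_ *m _).
by rewrite mul_mx_row mulmx1 mulmx0.
Qed.

Lemma mul_mx_diag_trE m n (N : 'M[K]_(m, n)) (R : comNzRingType)
    (h : {rmorphism K -> R}) (x : 'rV[R]_n) i j :
  (map_mx h N *m diag_mx x *m (map_mx h N)^T) i j =
    \sum_k h (N i k * N j k) * x 0 k.
Proof.
rewrite mul_mx_diag mxE; apply: eq_bigr => k _.
by rewrite !mxE rmorphM mulrAC.
Qed.

(* Choosing [d] to be the indicator function of the complement of [J] shows
   that the principal minor of [A] on [J] vanishes; [J] of size 1 and 2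
   suffice. *)
Lemma sym_pencil_eq0 r (A : 'M[K]_r) :
    A^T = A ->
    (forall d : 'rV[K]_r,
       \det (map_mx polyC (diag_mx d) + 'X *: map_mx polyC A) =
       (\det (diag_mx d))%:P) ->
  A = 0.
Proof.
move=> symA detA.
have ker (J : {set 'I_r}) a : a \in J -> exists u : 'rV[K]_r,
    [/\ u != 0, forall j, j \notin J -> u 0 j = 0
      & forall j, j \in J -> \sum_(i in J) u 0 i * A i j = 0].
  move=> Ja.
  (* [\det B] is the principal minor on [J]. [C] is the pencil of the indicator [d] below with a
     factor ['X] taken out of each column in [J]; at ['X = 0] it becomes [B]. *)
  pose B := \matrix_(i, j) if j \in J then A i j else (i == j)%:R.
  pose C := \matrix_(i, j) if j \in J then (A i j)%:P
                           else (i == j)%:R + 'X * (A i j)%:P.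
  have detC : \det C = 0.
    pose d : 'rV[K]_r := \row_j (j \notin J)%:R.
    pose s : 'rV[{poly K}]_r := \row_j if j \in J then 'X else 1.
    have: \det (C *m diag_mx s) = 0.
      rewrite (_ : C *m _ = map_mx polyC (diag_mx d) + 'X *: map_mx polyC A).
        rewrite detA det_diag (bigD1 a) //= mxE Ja mul0r.
        by rewrite polyC0.
      rewrite mul_mx_diag; apply/matrixP=> i j; rewrite !mxE.
      have [-> | _] := eqVneq i j; case: (j \in J) => /=;
        by rewrite ?(mulr0n, mulr1n, polyC0, add0r, mulr1) // mulrC.
    move/eqP; rewrite det_mulmx mulf_eq0 => /orP[/eqP // | ].
    rewrite det_diag prodf_seq_eq0 => /hasP[j _ /=].
    by rewrite mxE; case: ifP; rewrite ?oner_eq0 // polyX_eq0.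
  have: \det B = 0.
    rewrite (_ : B = map_mx (horner_eval 0) C) ?det_map_mx ?detC ?rmorph0 //.
    apply/matrixP=> i j; rewrite !mxE /horner_eval; case: ifP => _.
      by rewrite hornerC.
    by rewrite hornerD hornerM hornerX mul0r addr0 -polyC_natr hornerC.
  move/eqP/det0P=> [u u0 uB]; exists u.
  have uJ j : j \notin J -> u 0 j = 0.
    move=> /negPf Jj; move/rowP/(_ j): uB; rewrite !mxE (bigD1 j) //= big1.
      by rewrite mxE Jj eqxx mulr1 addr0.
    by move=> i /negPf ij; rewrite mxE Jj ij mulr0.
  split=> // j Jj; move/rowP/(_ j): uB; rewrite !mxE => uBj.
  rewrite -[RHS]uBj [RHS](bigID (mem J)) /= [X in _ = _ + X]big1 ?addr0.
    by apply: eq_bigr => i _; rewrite mxE Jj.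
  by move=> i /uJ->; rewrite mul0r.
have diagA i : A i i = 0.
  have [u [u0 uJ /(_ i)]] := ker [set i] i (set11 i).
  rewrite big_set1 set11 => /(_ isT)/eqP; rewrite mulf_eq0 => /orP[] /eqP // ui.
  case/eqP: u0; apply/rowP=> j; rewrite mxE; have [-> // | ji] := eqVneq j i.
  by rewrite uJ // inE.
apply/matrixP=> i j; rewrite mxE; have [-> // | ij] := eqVneq i j.
have Aji : A j i = A i j by rewrite -{1}symA mxE.
(* As the diagonal vanishes, the kernel relations read [u_i A_ij = 0] and [u_j A_ij = 0], so a
   nonzero [A_ij] would force [u = 0]. *)
have [u [u0 uJ uA]] := ker [set i; j] i (set21 i j).
apply/eqP/negPn/negP=> Aij; case/negP: u0; apply/eqP/rowP=> k; rewrite mxE.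
have := uA i (set21 _ _); have := uA j (set22 _ _).
rewrite !big_setU1 ?inE //= !big_set1 !diagA !mulr0 addr0 add0r Aji.
move=> /eqP; rewrite mulf_eq0 (negPf Aij) orbF => /eqP ui.
move=> /eqP; rewrite mulf_eq0 (negPf Aij) orbF => /eqP uj.
have [-> // | ki] := eqVneq k i; have [-> // | kj] := eqVneq k j.
by rewrite uJ // !inE negb_or ki.
Qed.

(** Points [x] supported on the columns of an invertible submatrix [P] of [N] give every
    [P *m diag_mx d *m P^T]. Cancelling the determinants of [P] and [P^T] leaves a pencil as in
    [sym_pencil_eq0]. *)
Lemma det_diag_congr_direction m n (N : 'M[K]_(m, n)) (v : 'rV[K]_n) :
    row_free N ->
    (forall x : 'rV[{poly K}]_n,
       \det (map_mx polyC N *m diag_mx (x + 'X *: map_mx polyC v)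
             *m (map_mx polyC N)^T) =
       \det (map_mx polyC N *m diag_mx x *m (map_mx polyC N)^T)) ->
  N *m diag_mx v *m N^T = 0.
Proof.
move=> freeN detv; have [f f_inj unitP] := row_free_colsub freeN.
set P := colsub f N in unitP; set A := N *m _ *m _.
have unitPt : P^T \in unitmx by rewrite unitmx_tr.
have [A' symA' defA] : exists2 A', A'^T = A' & A = P *m A' *m P^T.
  exists (invmx P *m A *m (invmx P)^T).
    by rewrite /A !(trmx_mul, trmxK) tr_diag_mx !mulmxA.
  by rewrite trmx_inv !mulmxA mulmxV // mul1mx mulmxKV.
rewrite defA (_ : A' = 0) ?mulmx0 ?mul0mx //; apply: sym_pencil_eq0 => //.
(* As [f] is injective, each sum has at most one term: [x] carries [d 0 i] at [f i] and 0
   elsewhere. *)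
move=> d; pose x : 'rV[K]_n := \row_k \sum_(i | f i == k) d 0 i.
have defx : N *m diag_mx x *m N^T = P *m diag_mx d *m P^T.
  apply/matrixP=> i j; rewrite !mul_mx_diag !mxE.
  rewrite [RHS](partition_big f predT) //=; apply: eq_bigr => k _.
  rewrite !mxE mulr_sumr mulr_suml; apply: eq_bigr => l /eqP <-.
  by rewrite !mxE.
have detP : \det (map_mx polyC P) != 0.
  by rewrite det_map_mx polyC_eq0 -unitfE -unitmxE.
have detPt : \det (map_mx polyC P^T) != 0 by rewrite -map_trmx det_tr.
have := detv (map_mx polyC x).
rewrite linearD mulmxDr mulmxDl linearZ /= -scalemxAr -scalemxAl.
rewrite -!map_diag_mx !map_trmx -!map_mxM defx -/A defA !map_mxM.
rewrite scalemxAl scalemxAr -mulmxDl -mulmxDr !det_mulmx.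
by move/(mulIf detPt)/(mulfI detP)->; rewrite -det_map_mx.
Qed.

End Matrices.

(** * Evaluation of polynomials in a commutative ring *)

Section Evaluation.
Variables (K : fieldType) (R : comNzRingType) (h : {rmorphism K -> R}).

Lemma mmap_comp_mpoly m n (t : n.-tuple {mpoly K[m]}) (y : 'I_m -> R) q :
  mmap h y (q \mPo t) = mmap h (fun i => mmap h y (tnth t i)) q.
Proof.
rewrite comp_mpolyEX raddf_sum; apply: eq_bigr => mon _.
rewrite /= mmapZ comp_mpolyX rmorph_prod; congr (_ * _).
by apply: eq_bigr => i _; rewrite rmorphXn.
Qed.

Lemma eq_mmap_vars m (q : {mpoly K[m]}) (y y' : 'I_m -> R) :
    (forall i, has (fun mon : 'X_{1..m} => mon i != 0%N) (msupp q) ->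
               y i = y' i) ->
  mmap h y q = mmap h y' q.
Proof.
move=> eq_y; apply: eq_big_seq => mon q_mon; congr (_ * _).
apply: eq_bigr => i _; have [-> // | mon_i] := eqVneq (mon i) 0%N.
by rewrite eq_y //; apply/hasP; exists mon.
Qed.

End Evaluation.

(** * Matrix form of the configuration polynomial; coordinate bases *)

Section ConfigurationMatrix.
Variables (K : fieldType) (E : finType).
Implicit Types (W U : {vspace coordspace K E}) (u : coordspace K E).

Definition conf_mx r (w : r.-tuple (coordspace K E)) : 'M[K]_(r, #|E|) :=
  \matrix_(i, k) tnth w i (enum_val k).

Lemma coord_scaleE (a : K) u e : (a *: u) e = a * u e.
Proof. by rewrite ffunE. Qed.

Lemma hadamard_mem W u v : u \in W -> v \in W -> hadamard u v \in hadamard_sq W.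
Proof. by move=> Wu Wv; move: (hadamard_sqP W _ (subvv _)); apply. Qed.

Lemma row_free_conf_mx r (w : r.-tuple (coordspace K E)) :
  free w -> row_free (conf_mx w).
Proof.
move=> /freeP freew; apply: inj_row_free => a aw0.
apply/rowP=> i; rewrite mxE; apply: (freew (fun i => a 0 i)).
apply/ffunP=> e; rewrite sum_ffunE ffunE.
move/rowP: aw0 => /(_ (enum_rank e)); rewrite !mxE => {2}<-.
by apply: eq_bigr => j _; rewrite coord_scaleE !mxE enum_rankK (tnth_nth 0).
Qed.

Lemma conf_polyE r (w : r.-tuple (coordspace K E)) :
  conf_poly w =
  \det (map_mx (@mpolyC #|E| K) (conf_mx w) *m diag_mx (\row_k 'X_k)
        *m (map_mx (@mpolyC #|E| K) (conf_mx w))^T).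
Proof.
congr (\det _); apply/matrixP=> i j; rewrite mul_mx_diag_trE mxE.
rewrite (reindex (fun k : 'I_#|E| => enum_val k)) /=; last first.
  exact: onW_bij (enum_val_bij E).
by apply: eq_bigr => k _; rewrite mxE enum_valK !mxE mul_mpolyC.
Qed.

(** The target [R] is general because it will be [{poly K}] for moving a point in a direction and
    [{mpoly K}] for substituting linear forms. *)
Lemma mmap_conf_poly r (w : r.-tuple (coordspace K E)) (R : comNzRingType)
    (h : {rmorphism K -> R}) (y : 'I_#|E| -> R) :
  mmap h y (conf_poly w) =
  \det (map_mx h (conf_mx w) *m diag_mx (\row_k y k) *m (map_mx h (conf_mx w))^T).
Proof.
rewrite conf_polyE -det_map_mx; congr (\det _); apply/matrixP=> i j.
rewrite mxE !mul_mx_diag_trE rmorph_sum; apply: eq_bigr => k _.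
by rewrite /= !mxE mul_mpolyC mmapZ mmapX mmap1U.
Qed.

(** The transition matrix [T] acts by congruence, which multiplies the determinant by the square of
    [\det T]. *)
Lemma conf_poly_change_basis W r1 r2 (w1 : r1.-tuple (coordspace K E))
    (w2 : r2.-tuple (coordspace K E)) :
    basis_of W w1 -> basis_of W w2 ->
  exists2 a, a != 0 & conf_poly w1 = a *: conf_poly w2.
Proof.
move=> W_w1 W_w2; have r12 : r1 = r2.
  by rewrite -(vector.size_basis W_w1) (vector.size_basis W_w2).
case: r2 / r12 w2 W_w2 => w2 W_w2.
pose T : 'M[K]_r1 := \matrix_(i, j) coord w2 j (tnth w1 i).
have defN : conf_mx w1 = T *m conf_mx w2.
  apply/matrixP=> i k; rewrite !mxE.
  rewrite {1}(coord_basis W_w2 (basis_mem W_w1 (mem_tnth i w1))) sum_ffunE.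
  by apply: eq_bigr => j _; rewrite coord_scaleE !mxE !(tnth_nth 0).
have detT : \det T != 0.
  rewrite -unitfE -unitmxE -row_free_unit /row_free eqn_leq rank_leq_row /=.
  have := mxrankM_maxl T (conf_mx w2).
  by rewrite -defN (eqP (row_free_conf_mx (basis_free W_w1))).
exists (\det T * \det T); first by rewrite mulf_neq0.
rewrite !conf_polyE defN map_mxM trmx_mul !mulmxA.
rewrite -!mulmxA det_mulmx !mulmxA det_mulmx det_tr det_map_mx -mul_mpolyC.
by rewrite mpolyCM mulrAC -mulrA mulrCA mulrA.
Qed.

(** Columns of the basis matrix [B] of [U] that form an invertible [C] give [F]. The coefficients
    are the entries of [invmx C *m B], which is the identity on these columns. *)
Lemma coordinate_basis U :
  exists2 F : {set E}, #|F| = \dim U &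
  exists2 c : E -> E -> K,
    {in U, forall u, forall e, u e = \sum_(g in F) c e g * u g} &
    {in F &, forall e g, c e g = (e == g)%:R}.
Proof.
pose B := conf_mx (vbasis U).
have [f f_inj unitC] := row_free_colsub (row_free_conf_mx (basis_free (vbasisP U))).
rewrite -/B in unitC; set C := colsub f B in unitC; pose G := invmx C *m B.
pose s k := enum_val (f k).
have s_inj : injective s by apply: inj_comp f_inj; apply: enum_val_inj.
have cE e k : \sum_(l | s l == s k) G l (enum_rank e) = G k (enum_rank e).
  by rewrite (big_pred1 k) // => l; rewrite /= (inj_eq s_inj).
exists [set s k | k : 'I_(\dim U)]; first by rewrite card_imset ?card_ord.
(* Injectivity of [s] leaves at most one [l] in the sum, which thus inverts [s] without choosing
   preimages. *)
exists (fun e g => \sum_(l | s l == g) G l (enum_rank e)) => [u Uu e|].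
  rewrite big_imset /=; last by move=> ? ? _ _ /s_inj.
  pose a : 'rV[K]_(\dim U) := \row_i coord (vbasis U) i u.
  have uE g : u g = (a *m B) 0 (enum_rank g).
    rewrite {1}(coord_vbasis Uu) sum_ffunE !mxE; apply: eq_bigr => i _.
    by rewrite coord_scaleE !mxE enum_rankK (tnth_nth 0).
  have aC : a *m C = \row_k u (s k).
    apply/rowP=> k; rewrite [RHS]mxE uE !mxE; apply: eq_bigr => i _.
    by rewrite !mxE enum_valK.
  rewrite uE -[B](mulKVmx unitC) -/G mulmxA aC mxE.
  by apply: eq_bigr => k _; rewrite cE mxE mulrC.
move=> _ _ /imsetP[k _ ->] /imsetP[l _ ->]; rewrite cE (inj_eq s_inj) eq_sym.
have /matrixP/(_ l k) := mulVmx unitC; rewrite !mxE => <-.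
by apply: eq_bigr => i _; rewrite !mxE enum_valK.
Qed.

Definition dot_row (v : 'rV[K]_#|E|) u : K^o := \sum_k u (enum_val k) * v 0 k.

Fact dot_row_is_linear v : linear (dot_row v).
Proof.
move=> a x y; rewrite /dot_row scaler_sumr -big_split /=; apply: eq_bigr => k _.
by rewrite ffunE coord_scaleE mulrDl -mulrA.
Qed.

HB.instance Definition _ v :=
  GRing.isLinear.Build K (coordspace K E) K^o _ (dot_row v)
    (dot_row_is_linear v).

(** The entries of the matrix are the pairings of [v] with the products of basis vectors. By
    bilinearity the kernel of [dot_row v] contains all products of vectors of [W], hence their
    span. *)
Lemma dot_row_hadamard_sq W r (w : r.-tuple (coordspace K E))
    (v : 'rV[K]_#|E|) :
    basis_of W w -> conf_mx w *m diag_mx v *m (conf_mx w)^T = 0 ->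
  {in hadamard_sq W, forall u, dot_row v u = 0}.
Proof.
move=> W_w w0 u; suff /subvP sub : (hadamard_sq W <= lker (linfun (dot_row v)))%VS.
  by move/sub; rewrite memv_ker lfunE => /eqP.
apply/hadamard_sqP=> {}u u' Wu Wu'; rewrite memv_ker lfunE; apply/eqP.
have rowW x : x \in W -> exists a : 'rV[K]_r,
    forall k, x (enum_val k) = (a *m conf_mx w) 0 k.
  move=> Wx; exists (\row_i coord w i x) => k.
  rewrite {1}(coord_basis W_w Wx) sum_ffunE mxE.
  by apply: eq_bigr => i _; rewrite coord_scaleE !mxE (tnth_nth 0).
have [[a ua] [a' ua']] := (rowW u Wu, rowW u' Wu').
transitivity ((a *m conf_mx w *m diag_mx v *m (a' *m conf_mx w)^T) 0 0).
  rewrite mul_mx_diag mxE; apply: eq_bigr => k _.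
  by rewrite ffunE ua ua' [X in _ = X * _]mxE [X in _ = _ * X]mxE mulrAC.
rewrite trmx_mul !mulmxA -2!(mulmxA a) w0.
by rewrite mulmx0 mul0mx mxE.
Qed.

End ConfigurationMatrix.

(** * The lower bound on the number of variables *)

Lemma rank2_le_num_vars (K : fieldType) (E : finType)
    (W : {vspace coordspace K E}) r (w : r.-tuple (coordspace K E)) m
    (phi : {mpoly K[m]}) :
  basis_of W w -> lin_equiv phi (conf_poly w) -> (rank2 W <= num_vars phi)%N.
Proof.
move=> W_w [p [le_mp [le_np [l [a [unit_l a0 def_phi]]]]]].
rewrite /num_vars; set S := finset _.
(* [v *m L] lists the coordinates in [S] of [invmx l] applied to [v] padded by zeros; if it
   vanishes, moving along [v] leaves the variables of [phi] fixed. *)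
pose L : 'M[K]_(#|E|, #|S|) := \matrix_(i, s)
  invmx l (widen_ord le_mp (enum_val s)) (widen_ord le_np i).
pose B := conf_mx (vbasis (hadamard_sq W)).
have rankB : \rank B = rank2 W.
  exact: (eqP (row_free_conf_mx (basis_free (vbasisP _)))).
(* Comparing dimensions of kernels gives [\rank B <= \rank L <= #|S|]. *)
suff sub : (kermx L <= kermx B^T)%MS.
  have := mxrankS sub; rewrite !mxrank_ker mxrank_tr rankB.
  rewrite leq_sub2lE; last by rewrite -rankB rank_leq_col.
  by move/leq_trans; apply; apply: rank_leq_col.
apply/rV_subP=> v /sub_kermxP vL; apply/sub_kermxP.
suff w0 : conf_mx w *m diag_mx v *m (conf_mx w)^T = 0.
  apply/rowP=> i; rewrite !mxE.
  transitivity (dot_row v (vbasis (hadamard_sq W))`_i).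
    by apply: eq_bigr => k _; rewrite !mxE mulrC (tnth_nth 0).
  apply: (dot_row_hadamard_sq W_w w0); apply: vbasis_mem.
  by rewrite mem_nth // size_tuple.
apply: det_diag_congr_direction => [|x].
  exact: row_free_conf_mx (basis_free W_w).
(* The inverse substitution: [l] takes [y z] to [z] padded by zeros, so [phi] at [y z] is [a] times
   [conf_poly w] at [z]. *)
pose y (z : 'rV[{poly K}]_#|E|) j :=
  \sum_i (invmx l j (widen_ord le_np i))%:P * z 0 i.
have eval_y z : mmap polyC (y z) (widen_mpoly le_mp phi) =
    a%:P * \det (map_mx polyC (conf_mx w) *m diag_mx z
                 *m (map_mx polyC (conf_mx w))^T).
  rewrite def_phi mmapZ; congr (_ * _).
  rewrite /lin_subst /widen_mpoly !mmap_comp_mpoly mmap_conf_poly.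
  congr (\det (_ *m diag_mx _ *m _)); apply/rowP=> k; rewrite mxE.
  rewrite tnth_mktuple mmapX mmap1U tnth_mktuple rmorph_sum /=.
  under eq_bigr do rewrite mmapZ mmapX mmap1U mulr_sumr.
  rewrite exchange_big /= (bigD1 k) //= [X in _ + X]big1 ?addr0 => [|i ik].
    under eq_bigr do rewrite mulrA -polyCM.
    rewrite -mulr_suml -rmorph_sum /=.
    have /matrixP/(_ (widen_ord le_np k) (widen_ord le_np k)) := mulmxV unit_l.
    by rewrite !mxE eqxx => ->; rewrite mul1r.
  under eq_bigr do rewrite mulrA -polyCM.
  rewrite -mulr_suml -rmorph_sum /=.
  have /matrixP/(_ (widen_ord le_np k) (widen_ord le_np i)) := mulmxV unit_l.
  rewrite !mxE -val_eqE /= val_eqE eq_sym (negPf ik) => ->.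
  by rewrite polyC0 mul0r.
have a0P : a%:P != 0 :> {poly K} by rewrite polyC_eq0.
apply: (mulfI a0P); rewrite -!eval_y /widen_mpoly !mmap_comp_mpoly.
apply: eq_mmap_vars => s phi_s; rewrite !tnth_mktuple !mmapX !mmap1U /y.
have Ss : s \in S by rewrite inE.
under eq_bigr do rewrite !mxE mulrDr.
(* The contribution of [v] is ['X] times the entry of [v *m L] at [s], which is 0. *)
rewrite big_split /= [X in _ + X](_ : _ = 0) ?addr0 //.
move/rowP/(_ (enum_rank_in Ss s)): vL; rewrite !mxE => vLs.
rewrite -[RHS](mulr0 'X) -[in RHS]polyC0 -vLs rmorph_sum mulr_sumr.
apply: eq_bigr => i _; rewrite !mxE enum_rankK_in // mulrCA.
by rewrite -polyCM [invmx _ _ _ * _]mulrC.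
Qed.

(** * Restriction to [F] and the equivalence of the two polynomials *)

Section Restriction.
Variables (K : fieldType) (E : finType) (W : {vspace coordspace K E}).
Variables (F : {set E}) (c : E -> E -> K).
Hypothesis c_hadamard :
  {in hadamard_sq W, forall (u : coordspace K E),
     forall e, u e = \sum_(g in F) c e g * u g}.
Hypothesis c_id : {in F &, forall e g, c e g = (e == g)%:R}.

Local Notation res := (linfun (restrict (K := K) F)).

Lemma sum_restrict (V : nmodType) (G : E -> V) :
  \sum_(g in F) G g = \sum_(k < #|{: {e : E | e \in F}}|) G (val (enum_val k)).
Proof.
rewrite big_sub (reindex (fun k : 'I_#|{: {e : E | e \in F}}| => enum_val k)) //.
exact: onW_bij (enum_val_bij _).
Qed.

Lemma restrict_hadamard u v :
  restrict F (hadamard u v) =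
    hadamard (restrict F u) (restrict F v) :> coordspace K _.
Proof. by apply/ffunP=> f; rewrite !ffunE. Qed.

Lemma mem_restrict u : u \in W -> restrict F u \in conf_restrict F W.
Proof. by move=> Wu; rewrite -[restrict F u](lfunE (restrict F)) memv_img. Qed.

Lemma hadamard_sq_restrict :
  hadamard_sq (conf_restrict F W) = (res @: hadamard_sq W)%VS.
Proof.
apply/eqP; rewrite eqEsubv; apply/andP; split.
  apply/hadamard_sqP=> _ _ /memv_imgP[u Wu ->] /memv_imgP[v Wv ->].
  rewrite !lfunE /= -restrict_hadamard -[restrict _ _](lfunE (restrict F)).
  by apply: memv_img; apply: hadamard_mem.
suff sub : (hadamard_sq W <= res @^-1: hadamard_sq (conf_restrict F W))%VS.
  by apply/subvP=> _ /memv_imgP[u /(subvP sub) Uu ->]; rewrite memv_preim.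
apply/hadamard_sqP=> u v Wu Wv; rewrite -memv_preim lfunE /= restrict_hadamard.
by apply: hadamard_mem; apply: mem_restrict.
Qed.

(** Elements of [hadamard_sq W] are determined by their coordinates in [F], so restriction is
    injective there. *)
Lemma rank2_restrict : rank2 (conf_restrict F W) = rank2 W.
Proof.
rewrite /rank2 hadamard_sq_restrict; apply/limg_dim_eq/eqP; rewrite -subv0.
apply/subvP=> u /memv_capP[Uu]; rewrite memv_ker lfunE /= memv0 => /eqP u0.
apply/eqP/ffunP=> e; rewrite (c_hadamard Uu) ffunE big1 // => g Fg.
by move/ffunP: u0 => /(_ (Sub g Fg)); rewrite !ffunE /= => ->; rewrite mulr0.
Qed.

(** If [u] in [W] vanishes on [F], so does [hadamard u u], which then vanishes everywhere; its
    coordinates are the squares of those of [u]. *)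
Lemma restrict_ker : (W :&: lker res = 0)%VS.
Proof.
apply/eqP; rewrite -subv0; apply/subvP=> u /memv_capP[Wu].
rewrite memv_ker lfunE /= memv0 => /eqP u0; apply/eqP/ffunP=> e.
have := c_hadamard (hadamard_mem Wu Wu) e; rewrite big1 => [|g Fg].
  by rewrite !ffunE => /eqP; rewrite mulf_eq0 orbb => /eqP.
move/ffunP: u0 => /(_ (Sub g Fg)); rewrite !ffunE /= => ->.
by rewrite !mulr0.
Qed.

Lemma conf_poly_restrict r (w : r.-tuple (coordspace K E)) :
    basis_of W w ->
  lin_equiv (conf_poly w) (conf_poly [tuple of map res w]).
Proof.
move=> W_w; pose T := {e : E | e \in F}.
have F_val (t : T) : val t \in F := valP t.
have le_FE : (#|{: T}| <= #|E|)%N by rewrite card_sig max_card.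
(* The rows of [A] are the new variables [y_f] as linear forms in the [x_e]. By [c_id] the columns
   in [F] form an identity matrix, whence the right inverse. *)
pose A : 'M[K]_(#|{: T}|, #|E|) :=
  \matrix_(k, i) c (enum_val i) (val (enum_val k)).
have freeA : row_free A.
  apply/row_freeP; exists (\matrix_(i, k) (enum_val i == val (enum_val k : T))%:R).
  apply/matrixP=> k l; rewrite !mxE (bigD1 (enum_rank (val (enum_val l)))) //=.
  rewrite big1 => [|i il]; rewrite !mxE ?enum_rankK.
    rewrite eqxx mulr1 addr0 c_id ?F_val //.
    by rewrite (inj_eq (@val_inj _ _ T)) (inj_eq enum_val_inj) eq_sym.
  case: eqP => [iE|_]; last by rewrite mulr0.
  by rewrite -iE enum_valK eqxx in il.
have [l unit_l rowl] := row_free_complete le_FE freeA.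
(* The rows that complete [A] to [l] belong to variables that do not occur in the widened polynomial
   of the restriction. *)
exists #|E|, (leqnn _), le_FE, l, 1; split; rewrite ?oner_neq0 // scale1r.
rewrite conf_polyE /lin_subst /widen_mpoly.
pose z k : {mpoly K[#|E|]} := \sum_j l (widen_ord le_FE k) j *: 'X_j.
have -> q : (q \mPo [tuple 'X_(widen_ord le_FE i) | i < #|{: T}|])
    \mPo [tuple \sum_j l i j *: 'X_j | i < #|E|] = mmap (@mpolyC #|E| K) z q.
  rewrite {1}/comp_mpoly mmap_comp_mpoly; apply: eq_mmap_vars => k _.
  by rewrite tnth_mktuple mmapX mmap1U tnth_mktuple.
have -> (q : {mpoly K[#|E|]}) :
    q \mPo [tuple 'X_(widen_ord (leqnn _) i) | i < #|E|] = q.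
  rewrite -[RHS]comp_mpoly_id; apply: eq_mmap_vars => i _; rewrite !tnth_mktuple.
  by rewrite (_ : widen_ord _ i = i) //; apply: val_inj.
rewrite mmap_conf_poly; congr (\det _); apply/matrixP=> i j.
rewrite !mul_mx_diag_trE.
have coordM e : tnth w i e * tnth w j e =
    \sum_(k < #|{: T}|) c e (val (enum_val k))
      * (conf_mx [tuple of map res w] i k * conf_mx [tuple of map res w] j k).
  have W_mem s : tnth w s \in W := basis_mem W_w (mem_tnth s w).
  have := c_hadamard (hadamard_mem (W_mem i) (W_mem j)) e.
  rewrite ffunE sum_restrict => ->; apply: eq_bigr => k _.
  by rewrite !mxE !tnth_map !lfunE /= !ffunE.
under [RHS]eq_bigr do rewrite mxE /z mulr_sumr.
rewrite exchange_big /=; apply: eq_bigr => e _.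
rewrite !mxE coordM rmorph_sum mulr_suml; apply: eq_bigr => k _ /=.
have /rowP/(_ e) := rowl k; rewrite !mxE => ->.
by rewrite !mul_mpolyC scalerA; congr (_ *: _); rewrite mulrC.
Qed.

End Restriction.

Theorem proposition5p3 (K : fieldType) (E : finType)
    (W : {vspace coordspace K E}) :
  exists F : {set E},
    [/\ #|F| = rank2 (conf_restrict F W),
        (rank2 (conf_restrict F W) <= rank2 W)%N
      & forall (w : (\dim W).-tuple (coordspace K E))
               (wF : (\dim (conf_restrict F W)).-tuple
                       (coordspace K {e : E | e \in F})),
          basis_of W w -> basis_of (conf_restrict F W) wF ->
          lin_equiv (conf_poly w) (conf_poly wF) /\
          ([pchar K] =i pred0 \/ (exists2 p, p \in [pchar K] & (\dim W < p)%N) ->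
            (forall (m : nat) (phi : {mpoly K[m]}),
                lin_equiv phi (conf_poly wF) -> (#|F| <= num_vars phi)%N) /\
            (forall (m : nat) (phi : {mpoly K[m]}),
                lin_equiv phi (conf_poly w) ->
                (num_vars (conf_poly wF) <= num_vars phi)%N))].
Proof.
have [F cardF [c c_hadamard c_id]] := coordinate_basis (hadamard_sq W).
have rankF := rank2_restrict c_hadamard.
exists F; split=> [||w wF W_w W_wF]; rewrite ?rankF //; split=> [|_].
  (* Restriction takes [w] to a basis of [conf_restrict F W]; passing from it to the given [wF]
     costs the scalar [a]. *)
  have [a a0 wE] := conf_poly_change_basis
    (limg_basis_of (restrict_ker c_hadamard) W_w) W_wF.
  have [p [le_mp [le_np [l [b [unit_l b0 def_w]]]]]] :=
    conf_poly_restrict c_hadamard c_id W_w.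
  exists p, le_mp, le_np, l, (b * a); split; [exact: unit_l | exact: mulf_neq0 |].
  rewrite def_w [conf_poly [tuple of _]]wE /lin_subst /widen_mpoly.
  rewrite comp_mpolyZ comp_mpolyZ; exact: scalerA.
split=> m phi phi_w.
  by rewrite cardF -[X in (X <= _)%N]rankF; apply: rank2_le_num_vars W_wF phi_w.
apply: leq_trans (rank2_le_num_vars W_w phi_w).
(* [conf_poly wF] lies in a polynomial ring in [#|F|] variables, and [#|F|] equals [rank2 W]. *)
rewrite /rank2 -cardF; apply: leq_trans (max_card _) _.
by rewrite card_ord card_sig.
Qed.
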